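(* Under the standing hypotheses (A) and (B), with $Y_n$ a random variable of law $\mathbb{Q}_n$, the following are equivalent: (i) the sequence $(Y_n/t_n)_{n\in\mathbb{N}}$ is tight; (ii) $Y_n/t_n$ converges in law to the probability distribution with density $\psi(x)/\int_{\mathbb{R}}\psi(u)\,du$; (iii) $\psi_n\to\psi$ in $L^1(\mathbb{R})$.
   Context: Standing setting: $(X_n)_{n\in\mathbb{N}}$ are real random variables with $\mathbb{E}[e^{zX_n}]<\infty$ for all $z$, and $t_n>0$ with $t_n\to+\infty$. Set $\psi_n(t)=\mathbb{E}[e^{tX_n}]e^{-t_nt^2/2}$ for $t\in\mathbb{R}$. Hypothesis (A): $\psi_n\to\psi$ locally uniformly on $\mathbb{R}$ for some continuous function $\psi$. Hypothesis (B): each $\psi_n$ and $\psi$ belong to $L^1(\mathbb{R})$. If $\mathbb{P}_n$ is the law of $X_n$, define the probability measure $\mathbb{Q}_n[dx]=\frac{e^{x^2/(2t_n)}}{\mathbb{E}[e^{X_n^2/(2t_n)}]}\mathbb{P}_n[dx]$ (well defined under (B)). Note $\psi(0)=1$ and $\psi\ge0$, so $\int\psi>0$. *)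

(* Defs.v *)
From HB Require Import structures.
From mathcomp Require Import all_boot all_order all_algebra.
From mathcomp Require Import all_classical all_reals all_analysis.
Set Implicit Arguments. Unset Strict Implicit. Unset Printing Implicit Defensive.
Import Order.TTheory GRing.Theory Num.Theory.
Import numFieldNormedType.Exports.
Local Open Scope classical_set_scope.
Local Open Scope ring_scope.

Section defs.
Context (R : realType) (d : measure_display) (T : measurableType d)
  (P : probability T R).

Definition mgf (X : T -> R) (z : R) : R :=
  fine (\int[P]_w (expR (z * X w))%:E).

Definition psin (X : nat -> T -> R) (tn : nat -> R) (n : nat) (s : R) : R :=
  mgf (X n) s * expR (- (tn n * s ^+ 2) / 2).

Definition Qnorm (X : nat -> T -> R) (tn : nat -> R) (n : nat) : \bar R :=
  \int[P]_w (expR ((X n w) ^+ 2 / (2 * tn n)))%:E.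

Definition Qlaw (X : nat -> T -> R) (tn : nat -> R) (n : nat) (A : set R)
  : \bar R :=
  ((fine (Qnorm X tn n))^-1)%:E *
  \int[P]_(w in X n @^-1` A) (expR ((X n w) ^+ 2 / (2 * tn n)))%:E.
End defs.

(* Main.v *)
Require Import Defs.
From HB Require Import structures.
From mathcomp Require Import all_boot all_order all_algebra.
From mathcomp Require Import all_classical all_reals all_analysis.
From mathcomp Require Import measurable_realfun.
From mathcomp Require Import ring lra.
Set Implicit Arguments. Unset Strict Implicit. Unset Printing Implicit Defensive.
Import Order.TTheory GRing.Theory Num.Theory.
Import numFieldNormedType.Exports.
Local Open Scope classical_set_scope.
Local Open Scope ring_scope.

(** Completing the square shows that [psin n / \int psin n] is the density of
    [Y n / t n + G / sqrt (t n)] with [G] a standard Gaussian independent of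
    [Y n]; equivalently [psin n s = c n * E[k (Y n / t n) s]], where [k y] is the
    Gaussian density of mean [y] and variance [1 / t n] and [c n = \int psin n].
    As [t n] tends to infinity the noise disappears, so tail masses and
    expectations of [Y n / t n] agree asymptotically with those of
    [psin n / c n].  Tightness therefore bounds the mass of [psin n] outside a
    large ball, uniformly in [n], by a small proportion of [c n]; with local
    uniform convergence this bounds [c n] and gives convergence in [L^1].
    Conversely [L^1] convergence transfers the tails and the integrals of
    [psi] back to [Y n / t n], and a sequence converging in law is tight. *)

(** * Gaussian kernels indexed by their precision *)

Section gauss_kernel.
Context {R : realType}.
Notation mu := (@lebesgue_measure R).
Implicit Types t y s : R.

(** The parameter [t] is the inverse of the variance, so that completing the square against
    [expR (- (t * s ^+ 2) / 2)] leaves no square root in the exponent. *)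
Definition gauss_kernel t y s : R :=
  Num.sqrt (t / (2 * pi)) * expR (- (t * (s - y) ^+ 2 / 2)).

Lemma gauss_kernelE t y s : 0 < t ->
  gauss_kernel t y s = normal_pdf y (Num.sqrt t)^-1 s.
Proof.
move=> t0; have s0 : 0 < Num.sqrt t by rewrite sqrtr_gt0.
rewrite normal_pdfE ?invr_neq0 ?gt_eqF// /normal_peak /normal_fun /gauss_kernel.
rewrite exprVn sqr_sqrtr ?(ltW t0)//; congr (_ * expR _).
  rewrite -sqrtrV; last by rewrite mulrn_wge0// mulr_ge0 ?pi_ge0// invr_ge0 ltW.
  congr Num.sqrt; have : (pi : R) != 0 by rewrite gt_eqF// pi_gt0.
  by move: (pi : R) => p p0; field; rewrite p0 gt_eqF.
by field; rewrite gt_eqF.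
Qed.

Lemma gauss_kernel_ge0 t y s : 0 <= gauss_kernel t y s.
Proof. by rewrite mulr_ge0 ?sqrtr_ge0 ?expR_ge0. Qed.

Lemma measurable_gauss_kernel d (T : measurableType d) t (f g : T -> R) :
  measurable_fun setT f -> measurable_fun setT g ->
  measurable_fun setT (fun x => gauss_kernel t (f x) (g x)).
Proof.
move=> mf mg; apply: measurable_funM => //; apply: measurableT_comp => //.
apply: measurableT_comp => //; apply: measurable_funM => //.
apply: measurable_funM => //; apply: measurable_funX.
exact: measurable_funB.
Qed.

Lemma integral_gauss_kernel t y : 0 < t ->
  (\int[mu]_s (gauss_kernel t y s)%:E = 1)%E.
Proof.
move=> t0; under eq_integral do rewrite gauss_kernelE//.
exact: integral_normal_pdf.
Qed.

(* The factor [exp (- t u^2 / 4)] left over after halving [t] is at most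
   [4 / (t u^2)], and [sqrt t <= 2 * sqrt (t / 2)]. *)
Lemma gauss_kernel_far t y s (dl : R) : 0 < t -> 0 < dl -> dl <= `|s - y| ->
  gauss_kernel t y s <= 8 / (t * dl ^+ 2) * gauss_kernel (t / 2) y s.
Proof.
move=> t0 d0 sy; rewrite /gauss_kernel.
have u2 : dl ^+ 2 <= (s - y) ^+ 2.
  by rewrite -(real_normK (num_real (s - y))) lerXn2r// nnegrE// ltW.
have u0 : 0 < dl ^+ 2 by rewrite exprn_gt0.
set a := t * (s - y) ^+ 2 / 4.
have a0 : 0 < a by rewrite /a; apply: divr_gt0 => //; apply: mulr_gt0 => //; lra.
have -> : - (t * (s - y) ^+ 2 / 2) = - a + - a by rewrite /a; lra.
have -> : - (t / 2 * (s - y) ^+ 2 / 2) = - a by rewrite /a; lra.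
rewrite expRD mulrCA [X in _ <= X](_ : _ = 4 / (t * dl ^+ 2) *
  (2 * Num.sqrt (t / 2 / (2 * pi)) * expR (- a))); last by lra.
apply: ler_pM; rewrite ?mulr_ge0 ?sqrtr_ge0 ?expR_ge0//.
  rewrite expRN -[leRHS]invrK lef_pV2 ?posrE ?expR_gt0//.
    apply: le_trans (ltW (expR_gt1Dx _)); last by rewrite gt_eqF.
    rewrite invfM invrK /a.
    have := ler_wpM2l (ltW t0) u2; lra.
  by rewrite invr_gt0 divr_gt0// mulr_gt0.
apply: ler_wpM2r; first exact: expR_ge0.
have -> : (2 : R) = Num.sqrt (2 ^+ 2) by rewrite sqrtr_sqr ger0_norm.
rewrite -sqrtrM ?sqr_ge0//; apply: ler_wsqrtr.
have -> : (Num.sqrt (2 ^+ 2) : R) = 2 by rewrite sqrtr_sqr ger0_norm.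
have : 0 < t / (2 * pi) by rewrite divr_gt0// mulr_gt0// pi_gt0.
rewrite (_ : t / 2 / (2 * pi) = t / (2 * pi) / 2); first by lra.
by rewrite mulrAC.
Qed.

End gauss_kernel.

(** * Layer-cake formula and change of law *)

Section layer_cake.
Context {R : realType}.
Notation mu := (@lebesgue_measure R).

(** Provides the joint measurability that Tonelli requires. The layer over [x] is the half-open
    interval from [0] to [f x], empty when [f x = 0]. *)
Lemma measurable_layers d (T : measurableType d) (f w : T -> R) :
  measurable_fun setT f -> measurable_fun setT w ->
  measurable_fun setT
    (fun z : T * R => ((0 <= z.2 < f z.1)%R%:R * w z.1)%:E).
Proof.
move=> mf mw; apply/measurable_EFinP; apply: measurable_funM; last first.
  exact: measurableT_comp.
have mb : measurable_fun setT (fun z : T * R => 0 <= z.2 < f z.1).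
  apply: measurable_and; first exact: measurable_fun_ler.
  by apply: measurable_fun_ltr => //; exact: measurableT_comp.
suff -> : (fun z : T * R => (0 <= z.2 < f z.1)%R%:R : R) =
    (\1_[set z : T * R | 0 <= z.2 < f z.1] : T * R -> R).
  apply: measurable_indic; rewrite -[X in measurable X]setTI.
  exact: (mb measurableT [set true]).
by apply/funext => z; rewrite indicE mem_setE.
Qed.

(** For fixed [x] the layer has Lebesgue measure [f x] and carries the constant weight [w x];
    Tonelli then exchanges the two integrals. *)
Lemma weighted_layer_cake d (T : measurableType d)
    (m : {sigma_finite_measure set T -> \bar R}) (f w : T -> R) :
  measurable_fun setT f -> measurable_fun setT w ->
  (forall x, 0 <= f x) -> (forall x, 0 <= w x) ->
  (\int[m]_x (f x * w x)%:E =
   \int[mu]_u \int[m]_x ((0 <= u < f x)%R%:R * w x)%:E)%E.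
Proof.
move=> mf mw f0 w0.
have F0 (z : T * R) : (0 <= ((0 <= z.2 < f z.1)%R%:R * w z.1)%:E)%E.
  by rewrite lee_fin mulr_ge0.
have /= := fubini_tonelli (m1 := m) (m2 := mu) _ (measurable_layers mf mw) F0.
move=> <-.
apply: eq_integral => x _ /=.
transitivity (\int[mu]_(u in `[0%R, f x[) (w x)%:E)%E.
  rewrite integral_cst//= lebesgue_measure_itv/= lte_fin.
  rewrite muleC; case: ltgtP (f0 x) => // [_|<-] _.
    by rewrite oppr0 adde0.
  by rewrite mul0r mul0e.
rewrite integral_mkcond; apply: eq_integral => u _.
rewrite patchE mem_setE in_itv/=.
by case: ifP; rewrite ?mul1r ?mul0r.
Qed.

(* Both sides are integrals over their level sets [h > u], on which the two
   laws agree by assumption. *)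
Lemma integral_law_density d (T : measurableType d) (P : probability T R)
    d' (T' : measurableType d') (P' : probability T' R)
    (X w : T -> R) (Y : T' -> R) (c : R) (h : R -> R) :
  measurable_fun setT X -> measurable_fun setT w -> measurable_fun setT Y ->
  (forall x, 0 <= w x) ->
  (forall A, measurable A ->
    P' (Y @^-1` A) = c%:E * \int[P]_(x in X @^-1` A) (w x)%:E)%E ->
  0 <= c -> measurable_fun setT h -> (forall y, 0 <= h y) ->
  (\int[P']_x (h (Y x))%:E = c%:E * \int[P]_x (h (X x) * w x)%:E)%E.
Proof.
move=> mX mw mY w0 law c0 mh h0.
have mhX : measurable_fun setT (h \o X) by exact: measurableT_comp.
have mhY : measurable_fun setT (h \o Y) by exact: measurableT_comp.
have mI (u : R) : measurable [set y | 0 <= u < h y].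
  rewrite -[X in measurable X]setTI.
  suff : measurable_fun setT (fun y => 0 <= u < h y).
    by move=> /(_ measurableT [set true]); apply.
  by apply: measurable_and => //; exact: measurable_fun_ltr.
rewrite (weighted_layer_cake P mhX mw) => // [|x]; last exact: h0.
rewrite -ge0_integralZl_EFin//; last 2 first.
- by move=> u _; apply: integral_ge0 => x _; rewrite lee_fin mulr_ge0.
- apply: (measurable_fun_fubini_tonelli_G _ (measurable_layers mhX mw)) => x.
  by rewrite lee_fin mulr_ge0.
transitivity (\int[P']_x (h (Y x) * 1)%:E)%E.
  by apply: eq_integral => x _; rewrite mulr1.
rewrite (weighted_layer_cake P' mhY (measurable_cst (1 : R))) => // [|x]; last exact: h0.
apply: eq_integral => u _ /=.
transitivity (\int[P']_(x in Y @^-1` [set y | (0 <= u < h y)%R]) 1%E)%E.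
  rewrite [RHS]integral_mkcond; apply: eq_integral => x _.
  rewrite patchE (_ : (x \in _) = (0 <= u < h (Y x))).
    by case: ifP; rewrite ?mulr1.
  by apply/idP/idP; rewrite inE.
rewrite integral_cst//=; last first.
  by rewrite -[X in measurable X]setTI; exact: (mY measurableT _ (mI u)).
rewrite mul1e (law _ (mI u)) integral_mkcond; congr (_ * _)%E.
apply: eq_integral => x _.
rewrite patchE (_ : (x \in _) = (0 <= u < h (X x))).
  by case: ifP; rewrite ?mul1r ?mul0r.
by apply/idP/idP; rewrite inE.
Qed.

End layer_cake.

(** * Integrals against a mixture of Gaussians centred at a random variable *)

Section smoothing.
Context {R : realType} {d : measure_display} {T : measurableType d}.
Variables (P : probability T R) (W : T -> R) (t c : R) (f : R -> R).
Notation mu := (@lebesgue_measure R).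
Hypothesis mW : measurable_fun setT W.
Hypothesis t0 : 0 < t.
Hypothesis c0 : 0 < c.
Hypothesis fE : forall s,
  ((f s)%:E = c%:E * \int[P]_x (gauss_kernel t (W x) s)%:E)%E.
Hypothesis intf : mu.-integrable setT (EFin \o f).

Lemma mixture_ge0 s : 0 <= f s.
Proof.
rewrite -lee_fin fE mule_ge0 ?lee_fin ?(ltW c0)//.
by apply: integral_ge0 => x _; rewrite lee_fin gauss_kernel_ge0.
Qed.

Let measurable_mixture (g : R -> R) : measurable_fun setT g ->
  measurable_fun setT
    (fun z : T * R => (g z.2 * gauss_kernel t (W z.1) z.2)%:E).
Proof.
move=> mg; apply/measurable_EFinP; apply: measurable_funM.
  exact: measurableT_comp.
by apply: measurable_gauss_kernel => //; exact: measurableT_comp.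
Qed.

Let mixture_ge0' (g : R -> R) (z : T * R) : (forall s, 0 <= g s) ->
  (0 <= (g z.2 * gauss_kernel t (W z.1) z.2)%:E)%E.
Proof. by move=> g0; rewrite lee_fin mulr_ge0 ?gauss_kernel_ge0. Qed.

Lemma integral_mixture (g : R -> R) :
  measurable_fun setT g -> (forall s, 0 <= g s) ->
  (\int[mu]_s (g s * f s)%:E =
   c%:E * \int[P]_x \int[mu]_s (g s * gauss_kernel t (W x) s)%:E)%E.
Proof.
move=> mg g0.
have /= -> := fubini_tonelli (m1 := P) (m2 := mu) _ (measurable_mixture mg)
  (fun z => mixture_ge0' z g0).
rewrite -ge0_integralZl_EFin//; last 3 first.
- by move=> s _; apply: integral_ge0 => x _; rewrite lee_fin mulr_ge0 ?gauss_kernel_ge0.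
- exact: (measurable_fun_fubini_tonelli_G _ (measurable_mixture mg)
    (fun z => mixture_ge0' z g0)).
- exact: ltW.
apply: eq_integral => s _; under [in RHS]eq_integral do rewrite EFinM.
rewrite ge0_integralZl_EFin//; last 2 first.
- by move=> x _; rewrite lee_fin gauss_kernel_ge0.
- by apply/measurable_EFinP; exact: measurable_gauss_kernel.
by rewrite EFinM fE muleCA.
Qed.

(** Take [g = 1] in [integral_mixture]: every kernel has mass one, so only the constant remains. *)
Lemma Rintegral_mixture : (\int[mu]_s f s)%R = c.
Proof.
rewrite /Rintegral; under eq_integral do rewrite -[f _]mul1r.
rewrite (@integral_mixture (cst 1))//.
under eq_integral do under eq_integral do rewrite mul1r.
under eq_integral do rewrite integral_gauss_kernel//.
by rewrite integral_cst//= probability_setT !mule1.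
Qed.

(* On [|s - y| >= dl] the Gaussian of variance [1/t] is dominated by
   [8 / (t dl^2)] times the Gaussian of variance [2/t]. *)
Lemma le_gauss_smoothing (g : R -> R) (y a eta C dl : R) :
  measurable_fun setT g -> (forall s, 0 <= g s) ->
  0 <= eta -> 0 <= C -> 0 < dl -> a <= C -> 0 <= a ->
  (forall s, `|s - y| < dl -> a <= g s + eta) ->
  (a%:E <= \int[mu]_s (g s * gauss_kernel t y s)%:E +
     (eta + C * (8 / (t * dl ^+ 2)))%:E)%E.
Proof.
move=> mg g0 eta0 C0 dl0 aC a0 Hg.
set b := 8 / _.
have b0 : 0 <= b by rewrite divr_ge0// mulr_ge0 ?ltW// exprn_gt0.
have mk u : measurable_fun setT (gauss_kernel u y).
  exact: measurable_gauss_kernel.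
have t20 : 0 < t / 2 by rewrite divr_gt0.
have E (u e : R) : 0 < u -> 0 <= e ->
    (e%:E = \int[mu]_s (e * gauss_kernel u y s)%:E)%E.
  move=> u0 e0; under eq_integral do rewrite EFinM.
  rewrite ge0_integralZl_EFin//; last 2 first.
  - by move=> x _; rewrite lee_fin gauss_kernel_ge0.
  - by apply/measurable_EFinP; exact: mk.
  by rewrite integral_gauss_kernel// mule1.
have k0 := @gauss_kernel_ge0 R.
rewrite EFinD [in leLHS](E t a)// [in leRHS](E t eta)//.
(* The far-field error is spread over the wider kernel of precision [t / 2], the one that
   [gauss_kernel_far] compares with; what remains is a pointwise inequality between integrands. *)
rewrite [in leRHS](E (t / 2) (C * b))//; last exact: mulr_ge0.
have meM u (h : R -> R) : measurable_fun setT h ->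
    measurable_fun setT (fun s => (h s * gauss_kernel u y s)%:E).
  by move=> mh; apply/measurable_EFinP; exact: measurable_funM.
have ge0M u (h : R -> R) s : (forall s, 0 <= h s) ->
    (0 <= (h s * gauss_kernel u y s)%:E)%E.
  by move=> h0; rewrite lee_fin mulr_ge0.
have mg0 := meM t g mg.
have mcst u (e : R) := meM u (cst e) (measurable_cst e).
have Cb0 : 0 <= C * b by rewrite mulr_ge0.
rewrite -ge0_integralD//; first last.
- exact: (mcst _ (C * b)).
- by move=> s _; exact: (ge0M _ (cst (C * b))).
- exact: (mcst _ eta).
- by move=> s _; exact: (ge0M _ (cst eta)).
rewrite -ge0_integralD//; first last.
- by apply: emeasurable_funD; [exact: (mcst _ eta)|exact: (mcst _ (C * b))].
- by move=> s _; rewrite adde_ge0// lee_fin mulr_ge0.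
- by move=> s _; exact: ge0M.
apply: ge0_le_integral => //.
- by move=> s _; exact: (ge0M _ (cst a)).
- exact: (mcst _ a).
- apply: emeasurable_funD => //.
  by apply: emeasurable_funD; [exact: (mcst _ eta)|exact: (mcst _ (C * b))].
move=> s _; rewrite -!EFinD lee_fin.
have [sy|sy] := ltP `|s - y| dl.
  have := ler_wpM2r (k0 t y s) (Hg _ sy).
  have : 0 <= C * b * gauss_kernel (t / 2) y s by rewrite mulr_ge0// mulr_ge0.
  lra.
have h1 := gauss_kernel_far t0 dl0 sy.
have h2 := ler_pM a0 (k0 _ _ _) aC h1.
have h3 : 0 <= g s * gauss_kernel t y s by rewrite mulr_ge0.
have h4 : 0 <= eta * gauss_kernel t y s by rewrite mulr_ge0.
rewrite -/b in h2; lra.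
Qed.

(** Averages [le_gauss_smoothing] at [y = W x] over [P]; where [W x] leaves [B], the bound [h <= C]
    accounts for the last term. Two functions are allowed so that the result serves both indicators
    of nested sets, with [eta = 0], and a single continuous function, with [g = h]. *)
Lemma le_Rintegral_smoothing (g h : R -> R) (B : set R) (eta C dl : R) :
  measurable_fun setT g -> measurable_fun setT h -> measurable B ->
  0 <= eta -> 0 < dl ->
  (forall s, 0 <= g s <= C) -> (forall s, 0 <= h s <= C) ->
  (forall y s, B y -> `|s - y| < dl -> h y <= g s + eta) ->
  (\int[P]_x h (W x) <= c^-1 * (\int[mu]_s (g s * f s)) + eta +
     C * (8 / (t * dl ^+ 2)) + C * fine (P [set x | ~ B (W x)]))%R.
Proof.
move=> mg mh mB eta0 dl0 gC hC Hgh.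
have g0 s : 0 <= g s by case/andP: (gC s).
have h0 s : 0 <= h s by case/andP: (hC s).
have C0 : 0 <= C by case/andP: (gC 0) => /le_trans; apply.
set b := 8 / _.
have b0 : 0 <= b by rewrite divr_ge0// mulr_ge0 ?ltW// exprn_gt0.
have mBW : measurable [set x | ~ B (W x)].
  rewrite -[X in measurable X]setTI.
  by apply: (mW measurableT (Y := ~` B)); exact: measurableC.
pose F x := (\int[mu]_s (g s * gauss_kernel t (W x) s)%:E)%E.
have mF : measurable_fun setT F.
  have /= := measurable_fun_fubini_tonelli_F (m2 := mu) _
    (measurable_mixture mg) (fun z => mixture_ge0' z g0).
  exact.
have F0 x : (0 <= F x)%E.
  by apply: integral_ge0 => s _; rewrite lee_fin mulr_ge0 ?gauss_kernel_ge0.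
(* The mixture formula for [g], divided by [c]; boundedness of [g] makes the integral of [g * f]
   finite. *)
have FE : (\int[P]_x F x = (c^-1 * (\int[mu]_s (g s * f s)))%:E)%E.
  have gf : mu.-integrable setT (EFin \o (fun s => g s * f s)).
    apply: (le_integrable _ _ _ (integrableZl _ C intf)) => //.
      apply/measurable_EFinP; apply: measurable_funM => //.
      by apply/measurable_EFinP; exact: measurable_int intf.
    move=> s _; rewrite -EFinM lee_fin !normrM ler_wpM2r// !ger0_norm//.
    by case/andP: (gC s).
  rewrite EFinM /Rintegral fineK; last exact: integrable_fin_num.
  rewrite integral_mixture// muleA -EFinM mulVf ?gt_eqF// mul1e.
  by [].
have hW : P.-integrable setT (EFin \o (h \o W)).
  apply: measurable_bounded_integrable => //.
  - by rewrite ltey_eq fin_num_measure.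
  - exact: measurableT_comp.
  - exists C; split; first exact: num_real.
    move=> M CM x _ /=; rewrite ger0_norm//.
    by apply: le_trans (ltW CM); case/andP: (hC (W x)).
rewrite -lee_fin {1}/Rintegral fineK; last exact: integrable_fin_num.
rewrite -(addrA (_ * _) eta) -addrA EFinD EFinD -FE.
pose ind x : R := \1_[set x | ~ B (W x)] x.
have mind : measurable_fun setT ind by exact: measurable_indic.
apply: (@le_trans _ _
    (\int[P]_x (F x + ((eta + C * b)%:E + (C * ind x)%:E)))%E).
  apply: ge0_le_integral => //.
  - by move=> x _; rewrite lee_fin; exact: h0.
  - by apply/measurable_EFinP; exact: measurableT_comp.
  - apply: emeasurable_funD => //; apply: emeasurable_funD => //.
    by apply/measurable_EFinP; exact: measurable_funM.
  move=> x _; rewrite addeA.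
  have [BW|BW] := pselect (B (W x)).
    have := @le_gauss_smoothing g (W x) (h (W x)) eta C dl mg g0 eta0 C0 dl0.
    move=> /(_ _ _ _)/le_trans; apply.
    + by case/andP: (hC (W x)).
    + exact: h0.
    + by move=> s; exact: Hgh.
    + by rewrite leeDl// lee_fin mulr_ge0.
  rewrite /ind indicE mem_set// mulr1.
  rewrite (@le_trans _ _ C%:E)//; first by rewrite lee_fin; case/andP: (hC (W x)).
  rewrite leeDr// adde_ge0// lee_fin addr_ge0// mulr_ge0//.
rewrite ge0_integralD//; first last.
- apply: emeasurable_funD => //.
  by apply/measurable_EFinP; exact: measurable_funM.
- by move=> x _; rewrite -EFinD lee_fin !addr_ge0// mulr_ge0.
apply: leeD => //.
rewrite ge0_integralD//; first last.
- by apply/measurable_EFinP; exact: measurable_funM.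
- by move=> x _; rewrite lee_fin mulr_ge0.
- by move=> x _; rewrite lee_fin addr_ge0// mulr_ge0.
rewrite integral_cst//= probability_setT mule1.
under eq_integral do rewrite EFinM.
rewrite ge0_integralZl_EFin//; first last.
- exact/measurable_EFinP.
- by move=> x _; rewrite lee_fin.
by rewrite integral_indic// setIT EFinM fineK; last exact: fin_num_measure.
Qed.

End smoothing.

(** * Truncation to balls and smallness of tails *)

Section truncation.
Context {R : realType}.
Notation K M := [set y : R | `|y| <= M].

Lemma measurable_normr_le (M : R) : measurable (K M).
Proof.
rewrite (_ : K M = `[- M, M]%classic); first exact: measurable_itv.
by apply/seteqP; split => y /=; rewrite in_itv/= ler_norml.
Qed.

Lemma integrable_indic_normr_le (M : R) :
  (@lebesgue_measure R).-integrable setT (EFin \o \1_(K M)).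
Proof.
rewrite (_ : K M = `[- M, M]%classic); first exact: integrable_indic_itv.
by apply/seteqP; split => y /=; rewrite in_itv/= ler_norml.
Qed.

Lemma indic_ge0_le1 (A : set R) s : 0 <= (\1_A s : R) <= 1.
Proof. by rewrite indicE; case: (_ \in _); rewrite ?lexx ?ler01. Qed.

Lemma integrable_bounded_mul d (T : measurableType d)
    (m : {measure set T -> \bar R}) (g f : T -> R) (C : R) :
  measurable_fun setT g -> (forall x, `|g x| <= C) ->
  m.-integrable setT (EFin \o f) ->
  m.-integrable setT (EFin \o (fun x => g x * f x)).
Proof.
move=> mg gC intf.
apply: eq_integrable (integrableMr measurableT mg _ intf) => //.
exists C; split; first exact: num_real.
by move=> M CM x _ /=; exact: le_trans (gC x) (ltW CM).
Qed.

Lemma normr_indic_le1 d (T : measurableType d) (A : set T) x :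
  `|\1_A x : R| <= 1.
Proof. by rewrite indicE ger0_norm//; case: (_ \in _). Qed.

Lemma Rintegral_truncation d (T : measurableType d)
    (m : {measure set T -> \bar R}) (A : set T) (f : T -> R) :
  measurable A -> m.-integrable setT (EFin \o f) ->
  \int[m]_x f x = \int[m]_x (\1_A x * f x) + \int[m]_x (\1_(~` A) x * f x).
Proof.
move=> mA intf; have mcA := measurableC mA.
rewrite -RintegralD//; first last.
- exact: integrable_bounded_mul (normr_indic_le1 _) intf.
- exact: integrable_bounded_mul (normr_indic_le1 _) intf.
apply: eq_Rintegral => x _; rewrite -mulrDl !indicE in_setC.
by case: (x \in A); rewrite ?(addr0, add0r) mul1r.
Qed.

(** The sets where [|W| <= n] increase to the whole space, so monotone convergence applies. With
    [W = id] this bounds the tail of a density; with [f = 1] it shows that one random variable is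
    tight. *)
Lemma exists_small_tail d (T : measurableType d)
    (m : {measure set T -> \bar R}) (W f : T -> R) (e : R) :
  measurable_fun setT W -> m.-integrable setT (EFin \o f) ->
  (forall x, 0 <= f x) -> 0 < e ->
  exists2 M : R, 0 <= M & forall N, M <= N ->
    \int[m]_x (\1_(~` (W @^-1` K N)) x * f x) < e.
Proof.
move=> mW intf f0 e0.
have mK (N : R) : measurable (W @^-1` K N).
  rewrite -[X in measurable X]setTI.
  exact: (mW measurableT _ (measurable_normr_le N)).
pose F n := W @^-1` K n%:R.
have FT : \bigcup_n F n = setT.
  apply/seteqP; split => // x _; exists (Num.bound `|W x|) => //=.
  by rewrite /F/=; apply/ltW/archi_boundP.
have cvgF : (\int[m]_(x in F n) (f x)%:E)%E @[n --> \oo] -->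
    (\int[m]_x (f x)%:E)%E.
  rewrite -[in X in _ --> X]FT.
  apply: ge0_nondecreasing_set_cvg_integral => //.
  - move=> i j ij; apply/subsetPset => x /= /le_trans; apply.
    by rewrite ler_nat.
  - by move=> i; exact: mK.
  - by move=> i; have := measurable_int _ intf; exact: measurable_funS.
  - by move=> i x _; rewrite lee_fin.
have FE n : (\int[m]_(x in F n) (f x)%:E)%E =
    (\int[m]_x (\1_(F n) x * f x)%:E)%E.
  rewrite integral_mkcond; apply: eq_integral => x _.
  by rewrite patchE indicE; case: ifP; rewrite ?mul1r ?mul0r.
have : (\int[m]_x (\1_(F n) x * f x)) @[n --> \oo] --> \int[m]_x f x.
  move: cvgF; under eq_fun do rewrite FE.
  have -> : (\int[m]_x (f x)%:E)%E = (\int[m]_x f x)%:E.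
    by rewrite /Rintegral fineK//; exact: integrable_fin_num.
  by move/fine_cvgP => [].
move/cvgrPdist_lt => /(_ _ e0) [n _ /(_ n (leqnn n))]/= Hn.
exists n%:R => // N nN.
apply: le_lt_trans Hn; rewrite (Rintegral_truncation (mK n%:R) intf).
rewrite addrAC subrr add0r; apply: le_trans (ler_norm _).
apply: le_Rintegral => //.
- apply: integrable_bounded_mul (normr_indic_le1 _) intf.
  by apply: measurable_indic; exact: measurableC.
- apply: integrable_bounded_mul (normr_indic_le1 _) intf.
  by apply: measurable_indic; exact: measurableC.
move=> x _; apply: ler_wpM2r => //; rewrite !indicE ler_nat.
have [/set_mem/= xN|//] := boolP (x \in ~` (W @^-1` K N)).
by rewrite mem_set//= => ?; apply: xN; apply: le_trans nN.
Qed.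

End truncation.

(* The mass [c] of [f], of which a proportion at least [1 - 2 e1] lies in the
   ball, controls the [L^1] distance [D] from [f] to [psi]. *)
Lemma L1_bound_arith (R : realFieldType) (e e1 I c v G G' T D : R) :
  0 < e1 -> e1 <= 1 / 4 -> 0 < I -> e1 * (6 + 4 * I) <= e -> 0 < c -> v <= e1 ->
  c = G + G' -> T < e1 -> G <= I + v -> D <= v + (G' + T) ->
  c * (1 - 2 * e1) <= G -> D <= e.
Proof.
move=> e10 e14 I0 e1I c0 ve cE Te GI Dv cG.
have c2 : c <= 2 * I + 1 / 2.
  have : 0 <= c * (1 / 4 - e1) by rewrite mulr_ge0 ?subr_ge0// ltW.
  lra.
have := ler_wpM2l (ltW e10) c2.
lra.
Qed.

(** Here [G] and [T] are the masses of [f] and [psi] outside a ball and [D] is their [L^1] distance.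
    Then [c >= I / 2] and [G <= e * I / 4], so the proportion [c^-1 * G] is at most [e / 2]. *)
Lemma tight_bound_arith (R : realFieldType) (e I c D tau G T : R) :
  0 < I -> 0 < e -> 0 < c -> D <= e * I / 8 -> D <= I / 2 -> tau < e / 4 ->
  T < e * I / 8 -> G - T <= D -> - D <= c - I -> c^-1 * G + tau < e.
Proof.
move=> I0 e0 c0 De DI te Te GT cI.
suff : c^-1 * G <= e / 2 by lra.
rewrite ler_pdivrMl//.
have : I / 2 * e <= c * e by apply: (ler_wpM2r (ltW e0)); lra.
lra.
Qed.

Lemma quarters_arith (R : realFieldType) (x y a b e : R) :
  x <= y + e / 4 -> a <= e / 4 -> b <= e / 4 -> x + e / 4 + a + b <= y + e.
Proof. by move=> *; lra. Qed.

Lemma osc_arith (R : realFieldType) (a b c e : R) :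
  a - b < e / 2 -> - (e / 2) < a - c -> c <= b + e.
Proof. by move=> *; lra. Qed.

(** Uniform continuity in which only [y] is confined to a compact interval, obtained from the
    near-covering form of compactness along radii tending to [0] from the right. *)
Lemma continuous_near_compact (R : realType) (g : R -> R) (M e : R) :
  continuous g -> 0 < e ->
  exists2 dl, 0 < dl & forall y s, `|y| <= M -> `|s - y| < dl -> g y <= g s + e.
Proof.
move=> cg e0.
have := @segment_compact R (- M) M => /compact_near_coveringP.
move=> /(_ R (0^'+) (fun dl y => forall s, `|s - y| < dl -> g y <= g s + e) _).
case.
  move=> x _; have e20 : 0 < e / 2 by rewrite divr_gt0.
  have /cvgrPdist_lt/(_ _ e20)/nbhs_ballP[r /= r0 xr] := cg x.
  have r20 : 0 < r / 2 by rewrite divr_gt0.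
  (* Halving the radius keeps both [y] and every [s] within [dl] of [y] inside the ball of radius
     [r] about [x]. *)
  exists (ball x (r / 2), [set dl | dl < r / 2]).
    by split; [exact: nbhsx_ballx|exact: nbhs_right_lt].
  move=> [y dl] [/= xy dlr] s sy.
  have hy : `|g x - g y| < e / 2.
    by apply: xr; apply: le_ball xy; rewrite ler_pdivrMr// ler_peMr// ?ltW//; lra.
  have hs : `|g x - g s| < e / 2.
    apply: xr; rewrite /ball/= -(subrK y x) -addrA.
    apply: le_lt_trans (ler_normD _ _) _; rewrite [r]splitr ltrD//.
    by rewrite distrC (lt_trans sy).
  move: hs hy; rewrite !ltr_norml => /andP[_ hs] /andP[hy _].
  exact: (osc_arith hs hy).
(* The covering yields every positive radius strictly below [dl], hence the choice of [dl / 2]. *)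
move=> dl /= dl0 Hdl; exists (dl / 2); first by rewrite divr_gt0.
move=> y s yM sy; apply: (Hdl (dl / 2)) => //=.
- by rewrite sub0r normrN gtr0_norm ?divr_gt0// ltr_pdivrMr// ltr_pMr// ltr1n.
- by rewrite divr_gt0.
- by rewrite in_itv/= -ler_norml.
Qed.

(** * Tightness, convergence in law and [L^1] convergence for a sequence of Gaussian mixtures *)

Section family.
Context {R : realType} {d : measure_display} {T : measurableType d}.
Variables (P : probability T R) (W : nat -> T -> R) (t c : nat -> R).
Variables (f : nat -> R -> R) (psi : R -> R).
Notation mu := (@lebesgue_measure R).
Notation K M := [set y : R | `|y| <= M].
Hypothesis mW : forall n, measurable_fun setT (W n).
Hypothesis t0 : forall n, 0 < t n.
Hypothesis ty : t n @[n --> \oo] --> +oo.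
Hypothesis c0 : forall n, 0 < c n.
Hypothesis fE : forall n s,
  ((f n s)%:E = (c n)%:E * \int[P]_x (gauss_kernel (t n) (W n x) s)%:E)%E.
Hypothesis intf : forall n, mu.-integrable setT (EFin \o f n).
Hypothesis intpsi : mu.-integrable setT (EFin \o psi).
Hypothesis psi0 : forall s, 0 <= psi s.
Hypothesis f_psi : forall M e : R, 0 < e ->
  \forall n \near \oo, forall s, `|s| <= M -> `|f n s - psi s| < e.

Let I := \int[mu]_s psi s.
Let D n := \int[mu]_s `|f n s - psi s|.

Hypothesis I0 : 0 < I.

Let f0 n s : 0 <= f n s.
Proof. exact: (mixture_ge0 (c0 n) (fE n)). Qed.

Let cE n : \int[mu]_s f n s = c n.
Proof. exact: (Rintegral_mixture (mW n) (t0 n) (c0 n) (fE n)). Qed.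

Let intD n : mu.-integrable setT (EFin \o (fun s => `|f n s - psi s|)).
Proof.
by have := integrable_norm (integrableB measurableT (intf n) intpsi); apply.
Qed.

Let mKW n (M : R) : measurable [set x | K M (W n x)].
Proof.
rewrite -[X in measurable X]setTI.
exact: (mW n measurableT (measurable_normr_le M)).
Qed.

Let PW_le n (M : R) : \int[P]_x (\1_(K M) (W n x)) =
  1 - fine (P [set x | ~ K M (W n x)]).
Proof.
rewrite (_ : [set x | ~ _] = ~` [set x | K M (W n x)])//.
rewrite probability_setC// fineB//; last exact: fin_num_measure.
rewrite /= opprB addrC subrK /Rintegral.
by rewrite (integral_indic _ measurableT (mKW n M)) setIT.
Qed.

Let t_small (a e : R) : 0 < e -> \forall n \near \oo, a / t n < e.
Proof.
move=> e0; move/cvgryPgt: ty => /(_ (a / e)); apply: filterS => n.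
by rewrite ltr_pdivrMr// ltr_pdivrMr// mulrC.
Qed.

Let Rintegral_diff_le (g : R -> R) (C : R) n :
  measurable_fun setT g -> (forall s, `|g s| <= C) ->
  `|\int[mu]_s (g s * f n s) - \int[mu]_s (g s * psi s)| <= C * D n.
Proof.
move=> mg gC.
have igf := @integrable_bounded_mul R _ _ mu _ _ _ mg gC (intf n).
have igp := @integrable_bounded_mul R _ _ mu _ _ _ mg gC intpsi.
rewrite -RintegralB// -RintegralZl//.
apply: le_trans (le_normr_Rintegral _ _) _ => //.
  exact: (integrableB measurableT igf igp).
apply: le_Rintegral => //.
- by have := integrable_norm (integrableB measurableT igf igp); apply.
- exact: (integrableZl measurableT C (intD n)).
by move=> s _; rewrite -mulrBr normrM ler_wpM2r.
Qed.

Let c_near n : `|c n - I| <= D n.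
Proof.
have : `|\int[mu]_s (cst 1 s * f n s) - \int[mu]_s (cst 1 s * psi s)| <= 1 * D n.
  by apply: Rintegral_diff_le => // s; rewrite normr1.
have E (h : R -> R) : \int[mu]_s (cst 1 s * h s) = \int[mu]_s h s.
  by apply: eq_Rintegral => s _; rewrite mul1r.
by rewrite !E cE mul1r.
Qed.

(** The case [C = dl = 1], [eta = 0], with [B] the whole line: it fits indicators of balls whose
    radii differ by one, or of their complements. *)
Let le_smoothing1 (g h : R -> R) n :
  measurable_fun setT g -> measurable_fun setT h ->
  (forall s, 0 <= g s <= 1) -> (forall s, 0 <= h s <= 1) ->
  (forall y s, `|s - y| < 1 -> h y <= g s) ->
  \int[P]_x h (W n x) <= (c n)^-1 * (\int[mu]_s (g s * f n s)) + 8 / t n.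
Proof.
move=> mg mh g01 h01 gh.
have := le_Rintegral_smoothing (mW n) (t0 n) (c0 n) (fE n) (intf n) (B := setT)
  mg mh measurableT (lexx 0) ltr01 g01 h01.
rewrite (_ : [set x | ~ _] = set0); last first.
  by apply/seteqP; split => x //=; apply.
rewrite measure0 /= mulr0 expr1n mulr1 mul1r !addr0; apply => y s _.
by rewrite addr0; exact: gh.
Qed.

(** Closed balls stand for compact sets, and the bound is over all [n]; [tight_near] recovers it
    from an eventual bound. *)
Definition tight_family := forall e : R, 0 < e ->
  exists M : R, forall n, fine (P [set x | ~ K M (W n x)]) < e.

(** Inside a large ball the local uniform convergence controls the distance; outside, the mass of
    [f n] is a small proportion of [c n], and [c n] is bounded because most of it lies in the
    ball. *)
Lemma tight_cvg_L1 : tight_family ->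
  forall e, 0 < e -> \forall n \near \oo, D n <= e.
Proof.
move=> tight e e0.
(* The bound [1 / 4] gives [c n <= 2 * I + 1 / 2]; the factor [6 + 4 * I] then leaves room for the
   total error [2 * e1 + 2 * e1 * c n]. *)
have [e1 [e10 e14 e1I]] : exists e1, [/\ 0 < e1, e1 <= 1 / 4 & e1 * (6 + 4 * I) <= e].
  have I4 : 0 < 6 + 4 * I by rewrite addr_gt0// mulr_gt0.
  exists (Num.min (1 / 4) (e / (6 + 4 * I))); split.
  - by rewrite lt_min divr_gt0//= divr_gt0.
  - by rewrite ge_min lexx.
  - by rewrite -ler_pdivlMr// ge_min lexx orbT.
have [M1 HM1] := tight _ e10.
have [M2 M20 HM2] := exists_small_tail (m := mu) (W := id) (@measurable_id _ _ _)
  intpsi psi0 e10.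
(* Smoothing at scale one enlarges the ball of radius [M1] by one; [M2] controls the tail of
   [psi]. *)
pose N := Num.max (M1 + 1) M2.
have mK := measurable_normr_le N.
have mcK := measurableC mK.
pose g : R -> R := \1_(K N).
pose g' : R -> R := \1_(~` K N).
have mg : measurable_fun setT g by exact: measurable_indic.
have mg' : measurable_fun setT g' by exact: measurable_indic.
have g01 s : 0 <= g s <= 1 := indic_ge0_le1 (K N) s.
have ig : mu.-integrable setT (EFin \o g).
  exact: integrable_indic_normr_le.
pose V := \int[mu]_s g s.
have V0 : 0 <= V by apply: Rintegral_ge0 => s _; case/andP: (g01 s).
(* [V] is the length of the ball, so a pointwise error [e2] integrates to at most [e1] over it;
   adding one keeps the denominator positive. *)
pose e2 := e1 / (V + 1).
have V1 : 0 < V + 1 by rewrite ltr_wpDl.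
have e20 : 0 < e2 by rewrite divr_gt0.
have e2V : e2 * V <= e1.
  by rewrite /e2 mulrAC ler_pdivrMr// ler_pM2l// lerDl.
near=> n.
have close : forall s, `|s| <= N -> `|f n s - psi s| < e2.
  by near: n; exact: f_psi.
have tn : 8 / t n < e1 by near: n; exact: t_small.
have igf := @integrable_bounded_mul R _ _ mu _ _ _ mg (normr_indic_le1 _) (intf n).
have igf' := @integrable_bounded_mul R _ _ mu _ _ _ mg' (normr_indic_le1 _) (intf n).
have igp' := @integrable_bounded_mul R _ _ mu _ _ _ mg' (normr_indic_le1 _) intpsi.
have ige2 : mu.-integrable setT (EFin \o (fun s => e2 * g s)).
  exact: (integrableZl measurableT e2 ig).
have split_f := @Rintegral_truncation R _ _ mu _ _ mK (intf n).
rewrite cE -/g -/g' in split_f.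
have tail_psi : \int[mu]_s (g' s * psi s) < e1.
  by apply: HM2; rewrite /N le_max lexx orbT.
have Gle : \int[mu]_s (g s * f n s) <= I + e2 * V.
  rewrite /V -RintegralZl// /I -RintegralD//.
  apply: le_Rintegral => //.
    exact: (integrableD measurableT intpsi ige2).
  move=> s _; rewrite /g indicE; have [/set_mem/= sN|_] := boolP (s \in K N).
    have := close _ sN; rewrite ltr_norml mul1r mulr1 => /andP[_].
    by rewrite ltrBlDl => /ltW.
  by rewrite mul0r mulr0 addr0.
(* One [e1] is lost to tightness and one to the smoothing error [8 / t n]. *)
have Gge : 1 - e1 <= (c n)^-1 * (\int[mu]_s (g s * f n s)) + e1.
  apply: le_trans (_ : _ <= \int[P]_x \1_(K M1) (W n x)) _.
    rewrite PW_le lerD2l lerN2 ltW//; exact: HM1.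
  apply: le_trans (le_smoothing1 n mg _ g01 (@indic_ge0_le1 R _) _) _.
  - by apply: measurable_indic; exact: measurable_normr_le.
  - move=> y s sy; rewrite /g !indicE.
    have [/set_mem/= yM|_] := boolP (y \in _); last by case: (_ \in _).
    rewrite mem_set//= /N le_max; apply/orP; left.
    by rewrite -(subrK y s) addrC; apply: le_trans (ler_normD _ _) (lerD yM (ltW sy)).
  by rewrite lerD2l ltW.
have Dle : D n <= e2 * V + (\int[mu]_s (g' s * f n s) + \int[mu]_s (g' s * psi s)).
  rewrite /V -RintegralZl// -!RintegralD//; last first.
    exact: (integrableD measurableT igf' igp').
  apply: le_Rintegral => //.
    exact: (integrableD measurableT ige2 (integrableD measurableT igf' igp')).
  move=> s _; rewrite /g /g' !indicE in_setC.
  have [/set_mem/= sN|_] := boolP (s \in K N).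
    by rewrite !mul0r !addr0 mulr1 ltW// close.
  rewrite mulr0 add0r !mul1r; apply: le_trans (ler_normB _ _) _.
  by rewrite !ger0_norm.
have : c n * (1 - 2 * e1) <= \int[mu]_s (g s * f n s).
  have : 1 - 2 * e1 <= (c n)^-1 * \int[mu]_s (g s * f n s).
    by rewrite mulr_natl mulr2n opprD addrA lerBlDr.
  by rewrite ler_pdivlMl.
exact: (L1_bound_arith e10 e14 I0 e1I (c0 n) e2V split_f tail_psi Gle Dle).
Unshelve. all: by end_near. Qed.

Let p n (M : R) := fine (P [set x | ~ K M (W n x)]).

Let pE n (M : R) : p n M = \int[P]_x \1_(~` K M) (W n x).
Proof.
by rewrite /p /Rintegral (integral_indic _ measurableT (measurableC (mKW n M))) setIT.
Qed.

Let p_mono n (M M' : R) : M <= M' -> p n M' <= p n M.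
Proof.
move=> MM'; rewrite /p fine_le ?fin_num_measure//.
- exact: measurableC (mKW n M').
- exact: measurableC (mKW n M).
apply: le_measure; rewrite ?inE.
- exact: measurableC (mKW n M').
- exact: measurableC (mKW n M).
by move=> x /= xM' xM; apply: xM'; apply: le_trans MM'.
Qed.

(** Each of the finitely many remaining indices has its own radius, and the maximum of all radii
    works since [p n] decreases in the radius. *)
Lemma tight_near : (forall e : R, 0 < e -> exists M : R, \forall n \near \oo,
    fine (P [set x | ~ K M (W n x)]) < e) -> tight_family.
Proof.
move=> H e e0; have [M [N _ HN]] := H _ e0.
have [M' HM'] : exists M', forall n, (n < N)%N -> p n M' < e.
  elim: N {HN} => [|N [M' IH]]; first by exists 0.
  have i1 : P.-integrable setT (EFin \o cst 1).
    by apply: finite_measure_integrable_cst.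
  have [M1 _ /(_ _ (lexx _))HM1] := exists_small_tail (mW N) i1 (fun=> ler01) e0.
  have {}HM1 : p N M1 < e.
    by rewrite pE; under eq_Rintegral do rewrite -[\1__ _]mulr1.
  exists (Num.max M' M1) => n; rewrite ltnS leq_eqVlt => /orP[/eqP ->|nN].
    by apply: le_lt_trans HM1; apply: p_mono; rewrite le_max lexx orbT.
  by apply: le_lt_trans (IH _ nN); apply: p_mono; rewrite le_max lexx.
exists (Num.max M M') => n; have [nN|Nn] := ltnP n N.
  by apply: le_lt_trans (HM' _ nN); apply: p_mono; rewrite le_max lexx orbT.
by apply: le_lt_trans (HN n Nn); apply: p_mono; rewrite le_max lexx.
Qed.

(** The tail of [psi] passes to [f n] at cost [D n], and then to [W n] by smoothing, with the radius
    raised by one. *)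
Lemma cvg_L1_tight : (forall e, 0 < e -> \forall n \near \oo, D n <= e) ->
  tight_family.
Proof.
move=> HD; apply: tight_near => e e0.
have e10 : 0 < e * I / 8 by rewrite divr_gt0// mulr_gt0.
have [M M0 /(_ _ (lexx _))HM] := exists_small_tail (m := mu) (W := id)
  (@measurable_id _ _ _) intpsi psi0 e10.
have mcK N : measurable (~` K N) := measurableC (measurable_normr_le N).
pose g : R -> R := \1_(~` K M).
have mg : measurable_fun setT g by exact: measurable_indic.
exists (M + 1); near=> n.
have Dn : D n <= e * I / 8 by near: n; exact: HD.
have Dn2 : D n <= I / 2 by near: n; apply: HD; rewrite divr_gt0.
have tn : 8 / t n < e / 4 by near: n; apply: t_small; rewrite divr_gt0.
rewrite -/(p n _) pE.
apply: le_lt_trans (le_smoothing1 n mg _ (@indic_ge0_le1 R _) (@indic_ge0_le1 R _) _) _.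
- by apply: measurable_indic.
- move=> y s sy; rewrite /g !indicE.
  have [/set_mem/= yM|_] := boolP (y \in _); last by case: (_ \in _).
  rewrite mem_set//= => sM; apply: yM.
  rewrite -(subrK s y) addrC; apply: le_trans (ler_normD _ _) (lerD sM _).
  by rewrite distrC ltW.
have := @Rintegral_diff_le g 1 n mg (normr_indic_le1 _).
rewrite mul1r ler_norml => /andP[_ gfp].
have := c_near n; rewrite ler_norml => /andP[cI _].
exact: (tight_bound_arith I0 e0 (c0 n) Dn Dn2 tn HM gfp cI).
Unshelve. all: by end_near. Qed.

(** The smoothing inequality is one-sided, hence an upper bound only; the lower bound comes later
    from [- g]. *)
Lemma cvg_L1_limsup_law : (forall e, 0 < e -> \forall n \near \oo, D n <= e) ->
  forall (g : R -> R) C, continuous g -> (forall s, 0 <= g s <= C) ->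
  forall e, 0 < e -> \forall n \near \oo,
    \int[P]_x g (W n x) <= (\int[mu]_s (g s * psi s)) / I + e.
Proof.
move=> HD g C cg gC e e0.
have mg : measurable_fun setT g by exact: continuous_measurable_fun.
have gC' s : `|g s| <= C by case/andP: (gC s) => g0 gC1; rewrite ger0_norm.
have C0 : 0 <= C by apply: le_trans (gC' 0).
have C10 : 0 < C + 1 by rewrite ltr_wpDl.
have e40 : 0 < e / 4 by rewrite divr_gt0.
have cvc : c n @[n --> \oo] --> I.
  apply/cvgrPdist_le => a a0; near=> n.
  by rewrite distrC (le_trans (c_near n))//; near: n; exact: HD.
have cvg : \int[mu]_s (g s * f n s) @[n --> \oo] --> \int[mu]_s (g s * psi s).
  apply/cvgrPdist_le => a a0; near=> n.
  rewrite distrC (le_trans (Rintegral_diff_le n mg gC'))//.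
  have : D n <= a / (C + 1) by near: n; apply: HD; rewrite divr_gt0.
  rewrite ler_pdivlMr//; apply: le_trans; rewrite mulrC ler_wpM2l ?lerDl//.
  exact: le_trans (normr_ge0 _) (c_near n).
have cvgr : (c n)^-1 * (\int[mu]_s (g s * f n s)) @[n --> \oo] -->
    I^-1 * (\int[mu]_s (g s * psi s)).
  by apply: cvgM => //; apply: cvgV => //; rewrite gt_eqF.
(* Tightness confines [W n] to a ball on which the oscillation of [g] is controlled uniformly; the
   exceptional event costs at most [e / 4]. *)
have [M HM] := cvg_L1_tight HD (divr_gt0 e40 C10).
have [dl dl0 Hdl] := continuous_near_compact M cg e40.
near=> n.
have := le_Rintegral_smoothing (mW n) (t0 n) (c0 n) (fE n) (intf n) mg mg
  (measurable_normr_le M) (ltW e40) dl0 gC gC Hdl.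
move/le_trans; apply.
have h1 : (c n)^-1 * (\int[mu]_s (g s * f n s)) <=
    I^-1 * (\int[mu]_s (g s * psi s)) + e / 4.
  rewrite -lerBlDl; apply: le_trans (ler_norm _) _; rewrite distrC.
  by near: n; move/cvgrPdist_le : cvgr; exact.
have h2 : C * (8 / (t n * dl ^+ 2)) <= e / 4.
  rewrite (_ : _ * _ = C * 8 / dl ^+ 2 / t n).
    by apply/ltW; near: n; exact: t_small.
  by rewrite invfM [(t n)^-1 * _]mulrC !mulrA.
have h3 : C * fine (P [set x | ~ K M (W n x)]) <= e / 4.
  have := HM n; rewrite ltr_pdivlMr// => /ltW; apply: le_trans.
  by rewrite mulrC ler_wpM2l// ?lerDl// fine_ge0.
rewrite [X in _ <= X + e]mulrC.
exact: quarters_arith h1 h2 h3.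
Unshelve. all: by end_near. Qed.

Definition cvg_law := forall g : R -> R, continuous g ->
  (exists C, forall x, `|g x| <= C) ->
  \int[P]_x g (W n x) @[n --> \oo] --> (\int[mu]_s (g s * psi s)) / I.

Let integrable_law (g : R -> R) (C : R) n : continuous g ->
  (forall x, `|g x| <= C) -> P.-integrable setT (EFin \o (g \o W n)).
Proof.
move=> cg gC; apply: measurable_bounded_integrable => //.
- by rewrite ltey_eq fin_num_measure.
- by apply: measurableT_comp => //; exact: continuous_measurable_fun.
- exists C; split; first exact: num_real.
  by move=> M CM x _ /=; apply: le_trans (ltW CM).
Qed.

(** Adding [C] makes a test function nonnegative and shifts both sides of the upper bound by [C].
    Applied to [g] and to [- g], the bound gives the two halves of the limit. *)
Lemma cvg_L1_cvg_law : (forall e, 0 < e -> \forall n \near \oo, D n <= e) ->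
  cvg_law.
Proof.
move=> HD g cg [C gC].
have half (h : R -> R) : continuous h -> (forall x, `|h x| <= C) ->
    forall e, 0 < e -> \forall n \near \oo,
    \int[P]_x h (W n x) <= (\int[mu]_s (h s * psi s)) / I + e.
  move=> ch hC e e0.
  pose g1 := fun s => h s + C.
  have cg1 : continuous g1.
    by move=> x; apply: cvgD; [exact: ch|exact: cvg_cst].
  have g1C s : 0 <= g1 s <= C + C.
    by have := hC s; rewrite ler_norml /g1 lerD2r -lerBlDr sub0r.
  have := cvg_L1_limsup_law HD cg1 g1C e0.
  apply: filterS => n.
  have mh := continuous_measurable_fun ch.
  have icst : mu.-integrable setT (EFin \o (fun s => C * psi s)).
    exact: (integrableZl measurableT C intpsi).
  have -> : \int[mu]_s (g1 s * psi s) = \int[mu]_s (h s * psi s) + C * I.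
    rewrite -RintegralZl// -RintegralD//.
      by apply: eq_Rintegral => s _; rewrite /g1 mulrDl.
    exact: (@integrable_bounded_mul R _ _ mu _ _ _ mh hC intpsi).
  have -> : \int[P]_x g1 (W n x) = \int[P]_x h (W n x) + C.
    rewrite RintegralD//; last 2 first.
    - exact: (integrable_law n ch hC).
    - exact: finite_measure_integrable_cst.
    rewrite Rintegral_cst//.
    by rewrite [fine _](congr1 fine (probability_setT P)) mulr1.
  by rewrite mulrDl mulfK ?gt_eqF// addrAC lerD2r.
apply/cvgrPdist_le => e e0; near=> n.
have h1 : \int[P]_x g (W n x) <= (\int[mu]_s (g s * psi s)) / I + e.
  by near: n; exact: half.
have h2 : \int[P]_x (- g (W n x)) <= (\int[mu]_s (- g s * psi s)) / I + e.
  near: n; apply: (half (fun x => - g x)) => // [x|x].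
    by apply: cvgN; exact: cg.
  by rewrite normrN.
have igp := @integrable_bounded_mul R _ _ mu _ _ _
  (continuous_measurable_fun cg) gC intpsi.
have e1 : \int[mu]_s (- g s * psi s) = - \int[mu]_s (g s * psi s).
  rewrite -mulN1r -RintegralZl//.
  by apply: eq_Rintegral => s _; rewrite mulN1r mulNr.
have e2 : \int[P]_x (- g (W n x)) = - \int[P]_x g (W n x).
  rewrite -mulN1r -RintegralZl//; last exact: (integrable_law n cg gC).
  by apply: eq_Rintegral => s _; rewrite mulN1r.
rewrite e1 e2 mulNr in h2.
rewrite distrC ler_norml lerBlDl h1 andbT lerBrDl.
by move: h2; rewrite -lerN2 opprD !opprK.
Unshelve. all: by end_near. Qed.

(** A continuous ramp lies between the indicators of [|x| > M + 1] and [|x| > M]: its limit is below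
    [e] by the tail of [psi], and it dominates the tail of [W n]. *)
Lemma cvg_law_tight : cvg_law -> tight_family.
Proof.
move=> H; apply: tight_near => e e0.
have eI0 : 0 < e * I by rewrite mulr_gt0.
have [M M0 /(_ _ (lexx _))HM] := exists_small_tail (m := mu) (W := id)
  (@measurable_id _ _ _) intpsi psi0 eI0.
pose g (x : R) : R := Num.min 1 (Num.max 0 (`|x| - M)).
have cg : continuous g.
  move=> x; apply: (@continuous_min _ _ (cst 1) (fun y => Num.max 0 (`|y| - M))).
    exact: cvg_cst.
  apply: (@continuous_max _ _ (cst 0) (fun y => `|y| - M)); first exact: cvg_cst.
  by apply: cvgB; [exact: norm_continuous|exact: cvg_cst].
have g0 x : 0 <= g x by rewrite le_min ler01 le_max lexx.
have g1 x : g x <= 1 by rewrite ge_min lexx.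
have gC x : `|g x| <= 1 by rewrite ger0_norm.
have mg := continuous_measurable_fun cg.
have gI : (\int[mu]_s (g s * psi s)) / I < e.
  rewrite ltr_pdivrMr//; apply: le_lt_trans HM.
  apply: le_Rintegral => //.
  - exact: (@integrable_bounded_mul R _ _ mu _ _ _ mg gC intpsi).
  - apply: (@integrable_bounded_mul R _ _ mu _ _ 1 _ (normr_indic_le1 _) intpsi).
    by apply: measurable_indic; exact: measurableC (measurable_normr_le M).
  move=> s _; apply: ler_wpM2r => //; rewrite indicE.
  have [//|] := boolP (s \in _).
  move=> /negP sM; rewrite /g (_ : Num.max _ _ = 0) ?ge_min ?lexx ?orbT//.
  apply/max_idPl; rewrite subr_le0; apply: contrapT => sM'; apply: sM.
  by rewrite inE.
exists (M + 1).
have : \forall n \near \oo, \int[P]_x g (W n x) < e.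
  have /cvgrPdist_lt := H g cg (ex_intro _ 1 gC).
  move=> /(_ (e - (\int[mu]_s (g s * psi s)) / I)).
  rewrite subr_gt0 => /(_ gI); apply: filterS => n.
  by rewrite distrC => /(le_lt_trans (ler_norm _)); rewrite ltrD2r.
apply: filterS => n; apply: le_lt_trans.
rewrite -/(p n _) pE; apply: le_Rintegral => //.
- exact: (integrable_indic P (measurableC (mKW n (M + 1)))).
- exact: (integrable_law n cg gC).
move=> x _; rewrite indicE; have [/set_mem/= WM|//] := boolP (W n x \in _).
rewrite /g le_min lexx/= le_max; apply/orP; right.
by rewrite lerBrDl ltW// ltNge; apply/negP.
Qed.

End family.

(** * The tilted law and its Gaussian mixture *)

Section tilting.
Context {R : realType} {d : measure_display} {T : measurableType d}.
Variables (P : probability T R) (X : nat -> {RV P >-> R}) (t : nat -> R).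
Context {d' : measure_display} {T' : measurableType d'}.
Variables (P' : probability T' R) (Y : nat -> {RV P' >-> R}).
Hypothesis intX :
  forall n z, P.-integrable setT (fun w => (expR (z * X n w))%:E).
Hypothesis t0 : forall n, 0 < t n.
Hypothesis lawY : forall n (A : set R), measurable A ->
  P' (Y n @^-1` A) = Qlaw P (fun k => X k : T -> R) t n A.

Let q n := fine (Qnorm P (fun k => X k : T -> R) t n).

(** Both a zero and an infinite [Qnorm] would give [q n = 0]; as the inverse of [0] is [0], [Qlaw]
    would then vanish on the whole line, where the law of [Y n] has mass one. *)
Lemma fine_Qnorm_gt0 n : 0 < q n.
Proof.
rewrite lt_neqAle fine_ge0 ?andbT; last first.
  by apply: integral_ge0 => x _; rewrite lee_fin expR_ge0.
apply/eqP => q0; have := lawY n measurableT.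
rewrite preimage_setT probability_setT /Qlaw -/(q n) -q0 invr0 mul0e => /eqP.
by rewrite eqe oner_eq0.
Qed.

(* Completing the square:
   [k_t(x / t, s) * exp (x^2 / (2 t)) = sqrt (t / 2 pi) * exp (s x - t s^2 / 2)]. *)
Lemma psin_mixture n s :
  ((psin P (fun k => X k : T -> R) t n s)%:E =
   (q n / Num.sqrt (t n / (2 * pi)))%:E *
     \int[P']_x (gauss_kernel (t n) (Y n x / t n) s)%:E)%E.
Proof.
have q0 := fine_Qnorm_gt0 n; have tn0 := t0 n.
set r := Num.sqrt _.
have r0 : 0 < r by rewrite sqrtr_gt0 divr_gt0// mulr_gt0// pi_gt0.
have mX : measurable_fun setT (X n) by [].
have mY : measurable_fun setT (Y n) by [].
pose w x := expR (X n x ^+ 2 / (2 * t n)).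
have mw : measurable_fun setT w.
  apply: measurableT_comp => //; apply: measurable_funM => //.
  exact: measurable_funX.
(* Turns the expectation of the kernel at [Y n] into one at [X n] weighted by [w], where the square
   can be completed. *)
rewrite (@integral_law_density R _ _ P _ _ P' (X n) w (Y n) (q n)^-1
  (fun y => gauss_kernel (t n) (y / t n) s)) //; last 5 first.
- by move=> x; exact: expR_ge0.
- by move=> A mA; rewrite lawY.
- by rewrite invr_ge0 ltW.
- by apply: measurable_gauss_kernel => //; exact: measurable_funM.
- by move=> y; exact: gauss_kernel_ge0.
pose b := r * expR (- (t n * s ^+ 2) / 2).
have b0 : 0 <= b by rewrite mulr_ge0 ?expR_ge0// ltW.
have E x : gauss_kernel (t n) (X n x / t n) s * w x = b * expR (s * X n x).
  rewrite /gauss_kernel -/r /w /b -!mulrA -!expRD; congr (_ * expR _).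
  by field; rewrite gt_eqF.
under eq_integral do rewrite E EFinM.
have mE : measurable_fun setT (fun x => (expR (s * X n x))%:E).
  exact: measurable_int (intX n s).
rewrite ge0_integralZl_EFin//.
rewrite -[X in (_ * (_ * (_ * X)))%E]fineK; last first.
  exact: integrable_fin_num (intX n s).
rewrite -!EFinM /psin /mgf /b; congr EFin.
move: (fine _) (expR _) => m e.
by field; rewrite !gt_eqF.
Qed.

End tilting.

(** * Positivity of the integral of the limit *)

Section limit_density.
Context {R : realType}.
Notation mu := (@lebesgue_measure R).

(** By continuity [psi] stays above [psi x / 2] on a half-open interval of length [r] starting at
    [x], so the integral is at least [psi x / 2 * r]. *)
Lemma continuous_integral_gt0 (psi : R -> R) (x : R) : continuous psi ->
  (forall s, 0 <= psi s) -> 0 < psi x ->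
  mu.-integrable setT (EFin \o psi) -> 0 < \int[mu]_s psi s.
Proof.
move=> cpsi psi0 px intpsi.
have px2 : 0 < psi x / 2 by rewrite divr_gt0.
have /cvgrPdist_lt/(_ _ px2)/nbhs_ballP[r /= r0 xr] := cpsi x.
pose i : interval R := Interval (BLeft x) (BLeft (x + r)).
have ii : mu.-integrable setT (EFin \o \1_[set` i]).
  exact: integrable_indic_itv.
have muE : lebesgue_measure [set` i] = r%:E.
  by rewrite lebesgue_measure_itv/= lte_fin ltrDl r0/= -EFinD addrAC subrr add0r.
have rE : \int[mu]_s \1_[set` i] s = r.
  rewrite /Rintegral integral_indic// setIT.
  exact: (congr1 fine muE).
apply: lt_le_trans (_ : psi x / 2 * r <= _); first by rewrite mulr_gt0.
rewrite -rE -RintegralZl//; apply: le_Rintegral => //.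
  exact: (integrableZl measurableT (psi x / 2) ii).
move=> s _; rewrite indicE mem_setE in_itv/=.
have [/andP[xs sr]|_] := boolP (_ <= s < _); last by rewrite mulr0.
have : `|psi x - psi s| < psi x / 2.
  by apply: xr; rewrite /ball/= distrC ger0_norm ?subr_ge0// ltrBlDl.
rewrite mulr1 ltr_norml => /andP[_]; rewrite ltrBlDr addrC -ltrBlDr => /ltW.
by apply: le_trans; rewrite {2}[psi x]splitr addrK.
Qed.

End limit_density.

(** * Equivalence of the three modes of convergence *)

Theorem theorem3p2 (R : realType)
  (d : measure_display) (T : measurableType d) (P : probability T R)
  (X : nat -> {RV P >-> R}) (t : nat -> R) (psi : R -> R)
  (d' : measure_display) (T' : measurableType d') (P' : probability T' R)
  (Y : nat -> {RV P' >-> R}) :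
  (* finite exponential moments *)
  (forall n z, P.-integrable setT (fun w => (expR (z * X n w))%:E)) ->
  (forall n, 0 < t n) ->
  t n @[n --> \oo] --> +oo ->
  (* Hypothesis (A): psi continuous, psi_n -> psi locally uniformly *)
  continuous psi ->
  (forall (M e : R), 0 < e ->
     \forall n \near \oo, forall s : R, `|s| <= M ->
        `|psin P (fun k => X k : T -> R) t n s - psi s| < e) ->
  (* Hypothesis (B): psi_n and psi are Lebesgue integrable *)
  (forall n, (@lebesgue_measure R).-integrable setT
               (fun s : R => (psin P (fun k => X k : T -> R) t n s)%:E)) ->
  (@lebesgue_measure R).-integrable setT (fun s : R => (psi s)%:E) ->
  (* Y_n has law Q_n *)
  (forall n (A : set R), measurable A ->
     P' (Y n @^-1` A) = Qlaw P (fun k => X k : T -> R) t n A) ->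
  [<->
    (* (i) (Y_n / t_n) is tight *)
    (forall e : R, 0 < e -> exists K : set R, compact K /\
       forall n, (P' [set w | ~ K (Y n w / t n)%R] < e%:E)%E);
    (* (ii) Y_n / t_n converges in law to the density psi / \int psi *)
    (forall f : R -> R, continuous f -> (exists C : R, forall x, `|f x| <= C) ->
       (fun n => Rintegral P' setT (fun w => f (Y n w / t n))) @ \oo -->
       Rintegral (@lebesgue_measure R) setT (fun x => f x * psi x)
         / Rintegral (@lebesgue_measure R) setT psi);
    (* (iii) psi_n -> psi in L^1(R) *)
    (fun n => (\int[@lebesgue_measure R]_s
        (`|psin P (fun k => X k : T -> R) t n s - psi s|)%:E)%E) @ \oo --> 0%E].
Proof.
set f := psin P (fun k => X k : T -> R) t.
move=> intX t0 ty cpsi f_psi intf intpsi lawY.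
pose W n w := Y n w / t n.
have mW n : measurable_fun setT (W n) by exact: measurable_funM.
(* The constant of [psin_mixture], hence the integral of [f n]. *)
pose c n := fine (Qnorm P (fun k => X k : T -> R) t n) /
  Num.sqrt (t n / (2 * pi)).
have c0 n : 0 < c n.
  rewrite divr_gt0 ?(fine_Qnorm_gt0 lawY)// sqrtr_gt0 divr_gt0// mulr_gt0//.
  exact: pi_gt0.
have fE n s := psin_mixture intX t0 lawY n s.
have f0 n s : 0 <= f n s := mixture_ge0 (c0 n) (fE n) s.
have f_psi_pt s e : 0 < e -> exists n, `|f n s - psi s| < e.
  move=> e0; have [N _ /(_ _ (leqnn N)) HN] := f_psi `|s| e e0.
  by exists N; exact: HN.
have psi0 s : 0 <= psi s.
  rewrite leNgt; apply/negP => ps0.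
  have [n] : exists n, `|f n s - psi s| < - psi s.
    by apply: f_psi_pt; rewrite oppr_gt0.
  rewrite ger0_norm; last by rewrite subr_ge0 (le_trans (ltW ps0)).
  by rewrite gtrDr ltNge f0.
(* Every [f n] equals [1] at [0], so being within [1] of some [f n 0] makes [psi 0] positive. *)
have psi00 : 0 < psi 0.
  have f1 n : f n 0 = 1.
    rewrite /f /psin /mgf; under eq_integral do rewrite mul0r expR0.
    rewrite integral_cst//= probability_setT mule1/=.
    by rewrite expr0n/= mulr0 oppr0 mul0r expR0 mulr1.
  have [n] := f_psi_pt 0 1 ltr01.
  by rewrite f1 ltr_norml => /andP[_]; rewrite ltrBlDr ltrDl.
have I0 := continuous_integral_gt0 cpsi psi0 psi00 intpsi.
have mWC n (A : set R) : measurable A -> measurable [set x | ~ A (W n x)].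
  move=> mA; rewrite -[X in measurable X]setTI.
  exact: (mW n measurableT _ (measurableC mA)).
have mK (M : R) : measurable [set y : R | `|y| <= M] := measurable_normr_le M.
have tightP : tight_family P' W <->
    (forall e : R, 0 < e -> exists K : set R, compact K /\
       forall n, (P' [set w | ~ K (Y n w / t n)%R] < e%:E)%E).
  split=> [tight e e0|tight e e0].
    have [M HM] := tight e e0.
    exists [set y | `|y| <= M]; split; last first.
      move=> n; have := HM n; rewrite -lte_fin fineK//.
      by apply: fin_num_measure; exact: (mWC n _ (mK M)).
    rewrite (_ : [set _ | _] = `[- M, M]%classic); first exact: segment_compact.
    by apply/seteqP; split => y /=; rewrite in_itv/= ler_norml.
  have [K [cK HK]] := tight e e0.
  (* Any real strictly above [M] bounds the compact set, hence [M + 1]. *)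
  have [M [_ /(_ (M + 1))KM]] := compact_bounded cK.
  exists (M + 1) => n; rewrite -lte_fin fineK; last first.
    by apply: fin_num_measure; exact: (mWC n _ (mK (M + 1))).
  apply: le_lt_trans (HK n); apply: le_measure; rewrite ?inE.
  - exact: (mWC n _ (mK (M + 1))).
  - exact: (mWC n K (compact_measurable cK)).
  by move=> x /= xM xK; apply: xM; apply: KM => //; rewrite ltrDl.
(* Passes between the real-valued epsilon form and the limit of extended-real integrals, which are
   finite by integrability. *)
have L1P : (forall e, 0 < e -> \forall n \near \oo,
      \int[lebesgue_measure]_s `|f n s - psi s| <= e) <->
    ((fun n => (\int[@lebesgue_measure R]_s (`|f n s - psi s|)%:E)%E) @ \oo --> 0%E).
  have -> : (fun n => (\int[@lebesgue_measure R]_s (`|f n s - psi s|)%:E)%E) =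
      EFin \o (fun n => \int[lebesgue_measure]_s `|f n s - psi s|).
    apply/funext => n /=; rewrite /Rintegral fineK//.
    apply: integrable_fin_num => //.
    by have := integrable_norm (integrableB measurableT (intf n) intpsi); apply.
  have D0 n : 0 <= \int[lebesgue_measure]_s `|f n s - psi s|.
    by apply: Rintegral_ge0.
  split=> H.
    apply/fine_cvgP; split; first exact: nearW.
    apply/cvgrPdist_le => e e0; apply: filterS (H e e0) => n.
    by rewrite sub0r normrN (ger0_norm (D0 n)).
  move/fine_cvgP : H => [_ /cvgrPdist_le H] e e0.
  by apply: filterS (H e e0) => n; rewrite sub0r normrN (ger0_norm (D0 n)).
have tight_L1 := tight_cvg_L1 mW t0 ty c0 fE intf intpsi psi0 f_psi I0.
have L1_law := cvg_L1_cvg_law mW t0 ty c0 fE intf intpsi psi0 I0.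
have law_tight := cvg_law_tight mW intpsi psi0 I0.
(* The cycle tight, [L^1], law, tight runs against the order of the list, so each of the three
   implications composes two of its arrows. *)
tfae.
- by move/tightP/tight_L1/L1_law.
- by move=> /law_tight/tight_L1/L1P.
- by move=> /L1P/L1_law/law_tight/tightP.
Qed.
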